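(* Let $X,Y$ be two random variables such that $X\trianglelefteq_uY$ for some ESI function $u$. Then: 1. $\mathbf E[X]\le\mathbf E[Y]$. If $u\equiv\eta$ is constant, then the inequality is strict unless $X=Y$ almost surely. 2. $X$ and $Y$ are ordered with high probability, that is, for all $\epsilon>0$ and $K\ge0$, $P(X\ge Y+\epsilon+K)\le e^{-u(\epsilon)K}$, or equivalently, for any $0<\delta\le1$, with probability at least $1-\delta$, $$X\le Y+\inf_{\epsilon>0}\left(\frac1{u(\epsilon)}\log\frac1\delta+\epsilon\right).$$ In the special case $u\equiv\eta$ constant, $P(X\ge Y+K)\le e^{-\eta K}$ for all $K\ge0$, or, for any $0<\delta\le1$, with probability at least $1-\delta$, $$X\le Y+\frac1\eta\log\frac1\delta.$$
   Context: Random variables are real-valued on a common probability space with well-defined (possibly infinite) expectations. An ESI function is a continuous, nondecreasing, strictly positive function $u:(0,\infty)\to(0,\infty)$. $X\trianglelefteq_uY$ means that for all $\epsilon>0$, $\mathbf E[e^{u(\epsilon)(X-Y)}]\le e^{u(\epsilon)\epsilon}$; for constant $u\equiv\eta$ this is equivalent to $\mathbf E[e^{\eta(X-Y)}]\le1$.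
   Formalization: Strictness for constant u is claimed only when E[X] < +∞ and E[Y] > −∞; otherwise both expectations equal the same infinity and it fails, e.g. X ≥ 0 with E[X] = +∞ and Y = X + 1. *)

(* Defs.v *)
From mathcomp Require Import all_boot all_order all_algebra.
From mathcomp Require Import all_classical all_reals all_analysis.

Set Implicit Arguments.
Unset Strict Implicit.
Unset Printing Implicit Defensive.

Import Order.TTheory GRing.Theory Num.Theory.
Import numFieldNormedType.Exports.

Local Open Scope classical_set_scope.
Local Open Scope ring_scope.

(* A function on (0, +oo) is represented by a total [u : R -> R] of which only
   the restriction to `]0, +oo[ is constrained or used. *)
Definition ESI_function (R : realType) (u : R -> R) : Prop :=
  [/\ {within [set` `]0, +oo[], continuous u},
      {in `]0, +oo[ &, nondecreasing_fun u} &
      forall e : R, 0 < e -> 0 < u e].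

(* 'E_P[X] is total in the library: it is the difference of the integrals of
   the positive and negative parts, with the convention +oo - +oo = -oo.  The
   predicate below excludes that junk value. *)
Definition has_expectation d (T : measurableType d) (R : realType)
    (P : probability T R) (X : {RV P >-> R}) : Prop :=
  ('E_P[X^\+] < +oo \/ 'E_P[X^\-] < +oo)%E.

Definition ESI d (T : measurableType d) (R : realType) (P : probability T R)
    (u : R -> R) (X Y : {RV P >-> R}) : Prop :=
  forall e : R, 0 < e ->
    ('E_P[fun w => expR (u e * (X w - Y w))] <= (expR (u e * e))%:E)%E.

(* Main.v *)
(* Markov's inequality for exp (u e (X - Y)) gives the tail bounds; for u = eta
   constant, letting e -> 0 first gives E exp (eta (X - Y)) <= 1. The infimum
   over e is handled by continuity of P from above.
   For the expectations, z <= exp z makes (X - Y)^+ integrable, so that either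
   E X = -oo, or E Y = +oo, or X and Y are both integrable. In the last case
   1 + z <= exp z and exp z - 1 <= z exp z give E (X - Y) <= e exp (u e * e),
   which vanishes as e -> 0 since u e <= u 1 for e <= 1. For constant u, if
   E X >= E Y then exp z - 1 - z >= 0, at z = eta (X - Y), has expectation at
   most 0, so it vanishes almost surely, that is X = Y almost surely. *)
Require Import Defs.
From mathcomp Require Import all_boot all_order all_algebra.
From mathcomp Require Import all_classical all_reals all_analysis.
From mathcomp Require Import measurable_realfun lra.
Import Order.TTheory GRing.Theory Num.Theory.
Import numFieldNormedType.Exports.
Local Open Scope classical_set_scope.
Local Open Scope ring_scope.

Set Implicit Arguments.
Unset Strict Implicit.
Unset Printing Implicit Defensive.

(** * Elementary inequalities for the exponential and for positive parts *)

(** This is [1 + z <= expR z] at [z = - x], multiplied by [expR x]. *)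
Lemma expR_sub1_le (R : realType) (x : R) : expR x - 1 <= x * expR x.
Proof.
have := expR_ge1Dx (- x); rewrite expRN -(ler_pM2r (expR_gt0 x)).
by rewrite mulVf ?gt_eqF ?expR_gt0//; lra.
Qed.

Lemma maxr0_leD (R : realDomainType) (x y : R) :
  Num.max x 0 <= Num.max y 0 + Num.max (x - y) 0.
Proof.
by case: (leP x 0) => ?; case: (leP y 0) => ?; case: (leP (x - y) 0) => ?; lra.
Qed.

(** * Integrability and expectations *)

Section expectation_lemmas.
Context (d : measure_display) (T : measurableType d) (R : realType).
Context (P : probability T R).

Lemma expectation_funrpos_funrneg (X : T -> R) :
  ('E_P[X] = 'E_P[X^\+] - 'E_P[X^\-])%E.
Proof. by rewrite unlock integralE funerpos funerneg. Qed.

Lemma ge0_expectation_Lfun1 (X : T -> R) :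
  measurable_fun setT X -> (forall w, 0 <= X w) -> ('E_P[X] < +oo)%E ->
  X \in Lfun P 1.
Proof.
rewrite unlock => mX X0 EX; apply/Lfun1_integrable/integrableP; split.
  exact/measurable_EFinP.
under eq_integral => w _ do rewrite /= ger0_norm//.
exact: EX.
Qed.

Lemma funrpos_funrneg_Lfun1 (X : T -> R) :
  measurable_fun setT X -> ('E_P[X^\+] < +oo)%E -> ('E_P[X^\-] < +oo)%E ->
  X \in Lfun P 1.
Proof.
move=> mX Xp Xn.
have -> : X = X^\+ - X^\- by rewrite funrposBneg.
apply: rpredB => //.
- by apply: ge0_expectation_Lfun1 => //; exact: measurable_funrpos.
- by apply: ge0_expectation_Lfun1 => //; exact: measurable_funrneg.
Qed.

Lemma le_expectationD_lty (X Y Z : T -> R) :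
  measurable_fun setT X -> measurable_fun setT Y -> measurable_fun setT Z ->
  (forall w, 0 <= X w) -> (forall w, 0 <= Y w) -> (forall w, 0 <= Z w) ->
  (forall w, X w <= Y w + Z w) ->
  ('E_P[Y] < +oo)%E -> ('E_P[Z] < +oo)%E -> ('E_P[X] < +oo)%E.
Proof.
move=> mX mY mZ X0 Y0 Z0 XYZ EY EZ.
apply: (@le_lt_trans _ _ ('E_P[Y \+ Z])%E).
  apply: expectation_le => //; first exact: measurable_funD.
  - by move=> w /=; rewrite addr_ge0.
  - by apply: aeW => w /=.
by rewrite expectationD ?lte_add_pinfty//; exact: ge0_expectation_Lfun1.
Qed.

Lemma expectation_funrpos_lty (r : R) (Z : T -> R) :
  0 < r -> measurable_fun setT Z ->
  ('E_P[fun w => expR (r * Z w)] < +oo)%E -> ('E_P[Z^\+] < +oo)%E.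
Proof.
move=> r0 mZ Ez.
have mE : measurable_fun setT (fun w => expR (r * Z w)).
  by apply: measurableT_comp => //; exact: measurable_funM.
have Ez1 : (fun w => expR (r * Z w)) \in Lfun P 1.
  by apply: ge0_expectation_Lfun1 => // w; exact: expR_ge0.
apply: (@le_lt_trans _ _ ('E_P[(r^-1 \o* (fun w => expR (r * Z w)))])%E).
  apply: expectation_le => //.
  - exact: measurable_funrpos.
  - exact: measurable_funM.
  - by move=> w /=; rewrite mulr_ge0 ?expR_ge0// invr_ge0 ltW.
  - apply: aeW => w /=.
    rewrite /funrpos ge_max divr_ge0 ?expR_ge0 ?(ltW r0)// andbT ler_pdivlMr//.
    by have := expR_ge1Dx (r * Z w); lra.
rewrite expectationZl//.
by rewrite lte_mul_pinfty// ?lee_fin ?invr_ge0 ?ltW.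
Qed.

(** The positive part is subadditive, so X^+ <= Y^+ + (X - Y)^+ and Y^- <= X^- + (X - Y)^+. Hence
    finiteness of E Y^+ passes to E X^+, and finiteness of E X^- passes to E Y^-. *)
Lemma expectation_cases (X Y : {RV P >-> R}) :
  has_expectation Y -> ('E_P[(X \- Y)%R^\+] < +oo)%E ->
  [\/ ('E_P[X] = -oo)%E, ('E_P[Y] = +oo)%E |
    (X : T -> R) \in Lfun P 1 /\ (Y : T -> R) \in Lfun P 1].
Proof.
move=> hY ED.
have mX : measurable_fun setT X by [].
have mY : measurable_fun setT Y by [].
have mD : measurable_fun setT (X \- Y)^\+.
  by apply: measurable_funrpos; exact: measurable_funB.
have mXp := measurable_funrpos mX; have mXn := measurable_funrneg mX.
have mYp := measurable_funrpos mY; have mYn := measurable_funrneg mY.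
have [EYp|] := ltP ('E_P[Y^\+])%E +oo%E; last first.
  rewrite leye_eq => /eqP EYp; apply: Or32.
  (* [has_expectation] makes E Y^- finite here, which rules out the value -oo that +oo - +oo would
     give. *)
  case: hY => [|EYn]; first by rewrite EYp.
  rewrite expectation_funrpos_funrneg EYp.
  have : (0 <= 'E_P[Y^\-])%E by apply: expectation_ge0 => w.
  by case: ('E_P[Y^\-])%E EYn.
have EXp : ('E_P[X^\+] < +oo)%E.
  apply: (le_expectationD_lty mXp mYp mD) => // w.
  exact: maxr0_leD.
have [EXn|] := ltP ('E_P[X^\-])%E +oo%E; last first.
  rewrite leye_eq => /eqP EXn; apply: Or31.
  rewrite expectation_funrpos_funrneg EXn.
  by case: ('E_P[X^\+])%E EXp.
have EYn : ('E_P[Y^\-] < +oo)%E.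
  apply: (le_expectationD_lty mYn mXn mD) => // w.
  (* Subadditivity at -Y and -X, whose difference is again X - Y. *)
  by have := maxr0_leD (- Y w) (- X w); rewrite opprK [- Y w + X w]addrC.
by apply: Or33; split; exact: funrpos_funrneg_Lfun1.
Qed.

(** Isolates the nonnegative remainder exp z - 1 - z: dropping it bounds E Z, and showing that its
    expectation is 0 settles the equality case. *)
Lemma expectation_expR (r : R) (Z : T -> R) :
  measurable_fun setT Z -> Z \in Lfun P 1 ->
  ('E_P[fun w => expR (r * Z w)] < +oo)%E ->
  ('E_P[fun w => expR (r * Z w)] =
   'E_P[fun w => (expR (r * Z w) - (1 + r * Z w))%R] + (1 + r%:E * 'E_P[Z]))%E.
Proof.
move=> mZ LZ Ez.
have mE : measurable_fun setT (fun w => expR (r * Z w)).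
  by apply: measurableT_comp => //; exact: measurable_funM.
have Ez1 : (fun w => expR (r * Z w)) \in Lfun P 1.
  by apply: ge0_expectation_Lfun1 => // w; exact: expR_ge0.
have LrZ : (r \o* Z) \in Lfun P 1 by rewrite Lfun_scale.
have L1 : cst 1 \in Lfun P 1 by exact: Lfun_cst.
have -> : (fun w => (expR (r * Z w) - (1 + r * Z w))%R) =
  (fun w => expR (r * Z w)) \- (cst 1 \+ r \o* Z).
  by apply/funext => w /=; rewrite [r * _]mulrC.
have LS : (cst 1 \+ r \o* Z) \in Lfun P 1 by exact: rpredD.
rewrite expectationB// -[(1 + _)%E](_ : 'E_P[(cst 1 \+ r \o* Z)%R] = _)%E;
  last first.
  by rewrite expectationD// expectation_cst expectationZl.
by rewrite subeK// expectation_fin_num.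
Qed.

(** * Tail bounds and their high-probability form *)

Lemma chernoff_sub (X Y : {RV P >-> R}) (r a b : R) :
  0 < r -> ('E_P[fun w => expR (r * (X w - Y w))] <= (expR b)%:E)%E ->
  (P [set w | (X w >= Y w + a)%R] <= (expR (b - r * a))%:E)%E.
Proof.
move=> r0 Eb.
have mZ : measurable_fun setT (X \- Y) by exact: measurable_funB.
pose Z : {RV P >-> R} := mfun_Sub (mem_set mZ).
have -> : [set w | (X w >= Y w + a)%R] = [set w | (a <= Z w)%R].
  by apply/funext => w /=; rewrite lerBrDl.
apply: (le_trans (chernoff Z a r0)).
have -> : 'M_P Z r = 'E_P[fun w => expR (r * (X w - Y w))]%E.
  by congr expectation; apply/funext => w /=; rewrite mulrC.
by rewrite expRD EFinM lee_wpmul2r// lee_fin expR_ge0.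
Qed.

(** Only levels strictly above [c] are needed, which suits an infimum that may not be attained: the
    event at [c] is the decreasing intersection of the events [F n] at [c + 1/(n+1)]. *)
Lemma le_probability_of_tail (X Y : {RV P >-> R}) (c delta : R) :
  (forall c', c < c' -> (P [set w | (X w >= Y w + c')%R] <= delta%:E)%E) ->
  ((1 - delta)%:E <= P [set w | (X w <= Y w + c)%R])%E.
Proof.
move=> tail.
pose F n := [set w | X w <= Y w + (c + n.+1%:R^-1)].
have mle a : measurable [set w | X w <= Y w + a].
  rewrite -[X in measurable X]setTI; apply: measurable_fun_le => //.
  exact: measurable_funD.
have capF : [set w | X w <= Y w + c] = \bigcap_n F n.
  apply/seteqP; split=> [w /= Xw n _|w /= Fw].
    by rewrite /F /= (le_trans Xw)// lerD2l lerDl.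
  apply/ler_addgt0Pr => e e0.
  have := @Fw (Num.truncn e^-1) I; rewrite /F /= addrA => /le_trans; apply.
  rewrite lerD2l invf_ple ?posrE//.
  by rewrite ltW// truncnS_gt.
rewrite capF; apply: (cvge_ge _ (@nonincreasing_cvg_mu _ _ _ P F _ _ _ _)).
- near=> n; rewrite /=.
  (* The complement of [F n] lies in the tail event at level [c + 1/(n+1)]. *)
  rewrite -[F n]setCK probability_setC; last exact/measurableC/mle.
  rewrite EFinB leeD2l // leeN2 (le_trans _ (tail (c + n.+1%:R^-1) _)) ?ltrDl//.
  apply: le_measure; rewrite ?inE.
  + exact/measurableC/mle.
  + rewrite -[X in measurable X]setTI; apply: measurable_fun_le => //.
    exact: measurable_funD.
  + by move=> w /= /negP; rewrite -ltNge => /ltW.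
- by rewrite (le_lt_trans (probability_le1 _ _)) ?ltry//; exact: mle.
- by move=> n; exact: mle.
- by rewrite -capF; exact: mle.
- move=> m n mn; apply/subsetPset => w /= /le_trans; apply.
  by rewrite !lerD2l lef_pV2 ?posrE// ler_nat.
Unshelve. all: by end_near.
Qed.

End expectation_lemmas.

(** * Tail and high-probability consequences of [ESI] *)

Section ESI_properties.
Context (d : measure_display) (T : measurableType d) (R : realType).
Context (P : probability T R) (X Y : {RV P >-> R}) (u : R -> R).
Hypotheses (hu : ESI_function u) (hXY : ESI u X Y).

Let u_gt0 e : 0 < e -> 0 < u e. Proof. by case: hu => _ _; apply. Qed.

Let mD : measurable_fun setT (X \- Y). Proof. exact: measurable_funB. Qed.

Let E_lty e : 0 < e -> ('E_P[fun w => expR (u e * (X w - Y w))] < +oo)%E.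
Proof. by move=> e0; rewrite (le_lt_trans (hXY e0)) ?ltry. Qed.

Lemma ESI_tail e K : 0 < e ->
  (P [set w | (X w >= Y w + e + K)%R] <= (expR (- (u e * K)))%:E)%E.
Proof.
move=> e0; have := chernoff_sub (e + K) (u_gt0 e0) (hXY e0).
rewrite mulrDr opprD addrA subrr add0r.
by under eq_set do rewrite addrA.
Qed.

Lemma ESI_cst_expectation_le1 eta : (forall e, 0 < e -> u e = eta) ->
  ('E_P[fun w => expR (eta * (X w - Y w))] <= 1)%E.
Proof.
move=> ueta; have eta0 : 0 < eta by rewrite -(ueta 1 ltr01) u_gt0.
have E0 : (0 <= 'E_P[fun w => expR (eta * (X w - Y w))])%E.
  by apply: expectation_ge0 => w; exact: expR_ge0.
have Ele e : 0 < e ->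
    ('E_P[fun w => expR (eta * (X w - Y w))] <= (expR (eta * e))%:E)%E.
  by move=> e0; have := hXY e0; rewrite ueta.
have := Ele _ ltr01; move: E0 Ele; case: ('E_P[_])%E => // x _ Ele _.
rewrite lee_fin leNgt; apply/negP => x1.
have lnx0 : 0 < ln x by rewrite ln_gt0.
(* This [e] makes the bound exp (ln x / 2), the square root of [x], which is below [x] since
   [x > 1]. *)
have := Ele (ln x / 2 / eta) ltac:(by rewrite !divr_gt0).
rewrite lee_fin mulrC divfK ?gt_eqF// => xle.
have : expR (ln x / 2) < x.
  by rewrite -[ltRHS]lnK ?posrE ?(lt_trans ltr01)// ltr_expR; lra.
by rewrite ltNge xle.
Qed.

Lemma ESI_cst_tail eta K : (forall e, 0 < e -> u e = eta) ->
  (P [set w | (X w >= Y w + K)%R] <= (expR (- (eta * K)))%:E)%E.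
Proof.
move=> ueta; have eta0 : 0 < eta by rewrite -(ueta 1 ltr01) u_gt0.
have := @chernoff_sub _ _ _ P X Y eta K 0 eta0.
by rewrite expR0 sub0r; apply; exact: ESI_cst_expectation_le1.
Qed.

Lemma ESI_le_probability delta : 0 < delta <= 1 ->
  ((1 - delta)%:E <=
   P [set w | (X w <= Y w
        + inf [set (u e)^-1 * ln (delta^-1) + e
              | e in [set e : R | (0 < e)%R]])%R])%E.
Proof.
move=> /andP[d0 d1]; apply: le_probability_of_tail => c' c'inf.
(* As [c'] exceeds the infimum, some [e] satisfies ln (1/delta) + u e * e < u e * c', and the
   Chernoff bound at that [e] is at most [delta]. *)
have [|_ [e /= e0 <-] fe] := inf_lt _ c'inf.
  by exists ((u 1)^-1 * ln delta^-1 + 1); exists 1 => //=.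
apply: (le_trans (chernoff_sub c' (u_gt0 e0) (hXY e0))).
rewrite lee_fin -[leRHS]lnK ?posrE// ler_expR.
have := u_gt0 e0 => ue0; move: fe; rewrite lnV ?posrE//.
rewrite -(ltr_pM2l ue0) mulrDr mulVKf ?gt_eqF//; lra.
Qed.

Lemma ESI_cst_le_probability eta delta : (forall e, 0 < e -> u e = eta) ->
  0 < delta <= 1 ->
  ((1 - delta)%:E <=
   P [set w | (X w <= Y w + eta^-1 * ln (delta^-1))%R])%E.
Proof.
move=> ueta /andP[d0 d1].
have eta0 : 0 < eta by rewrite -(ueta 1 ltr01) u_gt0.
apply: le_probability_of_tail => c' c'K.
apply: (le_trans (ESI_cst_tail c' ueta)).
rewrite lee_fin -[leRHS]lnK ?posrE// ler_expR.
by move: c'K; rewrite lnV ?posrE// -(ltr_pM2l eta0) mulVKf ?gt_eqF//; lra.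
Qed.

(** * Ordering of the expectations *)

Let ED_lty : ('E_P[(X \- Y)%R^\+] < +oo)%E.
Proof. exact: (expectation_funrpos_lty (u_gt0 ltr01) mD (E_lty ltr01)). Qed.

Lemma ESI_expectation_le : has_expectation Y -> ('E_P[X] <= 'E_P[Y])%E.
Proof.
move=> hY; have [->|->|[LX LY]] := expectation_cases hY ED_lty.
- by rewrite leNye.
- by rewrite leey.
have LD : (X \- Y) \in Lfun P 1 by exact: rpredB.
have := expectation_fin_num LX; have := expectation_fin_num LY.
have := expectationB LX LY.
case: ('E_P[X])%E => // x; case: ('E_P[Y])%E => // y ED _ _.
rewrite lee_fin -subr_le0; set m := x - y.
have bound e : 0 < e -> e <= 1 -> m <= e * expR (u 1).
  move=> e0 e1; have ue0 := u_gt0 e0.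
  have uele : u e * e <= u 1.
    have : u e <= u 1 by case: hu => _ + _; apply; rewrite ?in_itv/= ?e0 ?ltr01.
    by apply: le_trans; rewrite ler_piMr// ltW.
  have := hXY e0; rewrite (expectation_expR mD LD (E_lty e0)) ED.
  (* Discarding the nonnegative remainder leaves 1 + u e * m <= exp (u e * e). *)
  move=> /(le_trans (leeDr _ (expectation_ge0 _ _))) => H.
  have {H} : (1 + (u e)%:E * (x%:E - y%:E) <= (expR (u e * e))%:E)%E.
    by apply: H => w; rewrite subr_ge0 expR_ge1Dx.
  rewrite -EFinB -EFinM -EFinD lee_fin -/m => H.
  have : u e * m <= u e * (e * expR (u e * e)).
    by have := expR_sub1_le (u e * e); lra.
  rewrite ler_pM2l// => /le_trans; apply.
  by rewrite ler_pM2l// ler_expR.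
rewrite leNgt; apply/negP => m0.
have M0 := expR_gt0 (u 1).
(* The second argument of the minimum turns the bound into m <= m / 2, absurd for m > 0. *)
have := bound (Num.min 1 (m / 2 / expR (u 1))).
rewrite lt_min ltr01 !divr_gt0// ge_min lexx => /(_ isT isT).
apply/negP; rewrite -ltNge.
apply: (@le_lt_trans _ _ (m / 2)); last lra.
by rewrite -ler_pdivlMr// ge_min lexx orbT.
Qed.

(** The two conditions on infinite values exclude E X = E Y = +oo and E X = E Y = -oo, and settle
    the cases E X = -oo and E Y = +oo at once. *)
Lemma ESI_cst_expectation_lt eta : has_expectation Y ->
  (forall e, 0 < e -> u e = eta) ->
  ('E_P[X] < +oo)%E -> (-oo < 'E_P[Y])%E ->
  ~ {ae P, forall w, X w = Y w} -> ('E_P[X] < 'E_P[Y])%E.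
Proof.
move=> hY ueta EX EY neqXY.
have eta0 : 0 < eta by rewrite -(ueta 1 ltr01) u_gt0.
have [->//|->//|[LX LY]] := expectation_cases hY ED_lty.
rewrite ltNge; apply/negP => EYX; apply: neqXY.
have LD : (X \- Y) \in Lfun P 1 by exact: rpredB.
have E1 := ESI_cst_expectation_le1 ueta.
pose G w := expR (eta * (X w - Y w)) - (1 + eta * (X w - Y w)).
have G0 w : 0 <= G w by rewrite subr_ge0 expR_ge1Dx.
have mG : measurable_fun setT G.
  apply: measurable_funB; last first.
    by apply: measurable_funD => //; exact: measurable_funM.
  by apply: measurableT_comp => //; exact: measurable_funM.
have EG : ('E_P[G] = 0)%E.
  apply/eqP; rewrite eq_le expectation_ge0// andbT.
  move: E1; rewrite (expectation_expR mD LD); last first.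
    by rewrite -(ueta 1 ltr01); exact: E_lty ltr01.
  move: EYX; rewrite (expectationB LX LY).
  have := expectation_fin_num LX; have := expectation_fin_num LY.
  case: ('E_P[X])%E => // x; case: ('E_P[Y])%E => // y _ _.
  rewrite lee_fin => xy; rewrite -/G.
  case: ('E_P[G])%E => // g; rewrite -EFinB -EFinM -!EFinD !lee_fin.
  have : 0 <= eta * (x - y) by rewrite mulr_ge0 ?subr_ge0 ?(ltW eta0).
  lra.
have : (\int[P]_(w in setT) `|(G w)%:E| = 0)%E.
  rewrite -EG unlock; apply: eq_integral => w _.
  by rewrite gee0_abs ?lee_fin.
have mEG : measurable_fun setT (EFin \o G) by exact/measurable_EFinP.
(* [G] vanishes almost everywhere, while 1 + z < exp z for z <> 0 makes it positive wherever X and Y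
   differ. *)
move/(ae_eq_integral_abs P measurableT mEG); apply: filterS => w /(_ I) /= [].
apply: contraPP => /eqP XY /eqP; apply/negP.
rewrite subr_eq0 gt_eqF// expR_gt1Dx// mulf_neq0 ?subr_eq0//.
by rewrite gt_eqF.
Qed.

End ESI_properties.

Theorem proposition4 (d : measure_display) (T : measurableType d)
    (R : realType) (P : probability T R) (X Y : {RV P >-> R}) (u : R -> R)
    (hX : has_expectation X) (hY : has_expectation Y)
    (hu : ESI_function u) (hXY : ESI u X Y) :
  (* 1 *)
  ([/\ ('E_P[X] <= 'E_P[Y])%E &
       forall eta : R, (forall e : R, 0 < e -> u e = eta) ->
         ('E_P[X] < +oo)%E -> (-oo < 'E_P[Y])%E ->
         ~ {ae P, forall w, X w = Y w} ->
         ('E_P[X] < 'E_P[Y])%E])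
  /\
  (* 2 *)
  [/\ (forall e K : R, 0 < e -> 0 <= K ->
         (P [set w | (X w >= Y w + e + K)%R] <= (expR (- (u e * K)))%:E)%E),
      (forall delta : R, 0 < delta <= 1 ->
         ((1 - delta)%:E <=
          P [set w | (X w <= Y w
               + inf [set (u e)^-1 * ln (delta^-1) + e
                     | e in [set e : R | (0 < e)%R]])%R])%E) &
      forall eta : R, (forall e : R, 0 < e -> u e = eta) ->
        (forall K : R, 0 <= K ->
           (P [set w | (X w >= Y w + K)%R] <= (expR (- (eta * K)))%:E)%E)
        /\
        (forall delta : R, 0 < delta <= 1 ->
           ((1 - delta)%:E <=
            P [set w | (X w <= Y w + eta^-1 * ln (delta^-1))%R])%E)].
Proof.
split; first split.
- exact: (ESI_expectation_le hu hXY hY).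
- by move=> eta ueta; exact: (ESI_cst_expectation_lt hu hXY hY ueta).
split.
- by move=> e K e0 _; exact: (ESI_tail hu hXY).
- exact: (ESI_le_probability hu hXY).
- move=> eta ueta; split.
  + by move=> K _; exact: (ESI_cst_tail hu hXY).
  + by move=> delta; exact: (ESI_cst_le_probability hu hXY).
Qed.
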